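(* Let $G$ be a finite simple cubic (3-regular) graph on $n$ vertices, and let $\lambda_n$ be the largest Laplacian eigenvalue of $G$. Then $$\mathrm{oct}(G)\ \ge\ \frac{\sum_{v\in V(G)}d(v)^2-|E(G)|\,\lambda_n}{8}=\frac{3n(6-\lambda_n)}{16}.$$
   Context: Here $d(v)$ is the degree of $v$, the Laplacian is the degree matrix minus the adjacency matrix, and $\mathrm{oct}(G)$ is the odd cycle transversal number: the minimum size of a set $S\subseteq V(G)$ such that the induced subgraph $G[V(G)\setminus S]$ is bipartite. *)

(* Defs.v *)
From HB Require Import structures.
From mathcomp Require Import all_boot all_order all_algebra.

Set Implicit Arguments.
Unset Strict Implicit.
Unset Printing Implicit Defensive.

Import Order.TTheory GRing.Theory Num.Theory.

Local Open Scope ring_scope.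

(* A finite simple graph is a symmetric irreflexive relation [e] on a finType *)
(* [V] of vertices.                                                           *)

Definition degree (V : finType) (e : rel V) (v : V) : nat := #|[set w | e v w]|.

Definition cubic (V : finType) (e : rel V) : Prop :=
  forall v : V, degree e v = 3%N.

Definition edges (V : finType) (e : rel V) : {set {set V}} :=
  [set [set p.1; p.2] | p : V * V & e p.1 p.2].

Definition independent (V : finType) (e : rel V) (X : {set V}) : bool :=
  [forall x in X, forall y in X, ~~ e x y].

Definition bipartite (V : finType) (e : rel V) : bool :=
  [exists X : {set V}, independent e X && independent e (~: X)].

Definition induced (V : finType) (e : rel V) (A : {set V}) :
    rel {x : V | x \in A} :=
  fun x y => e (val x) (val y).
Arguments induced [V] e A _ _.

Definition oct_set (V : finType) (e : rel V) (S : {set V}) : bool :=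
  bipartite (induced e (~: S)).

(* The default [setT] of the [arg min] below is always admissible. *)
Lemma oct_setT (V : finType) (e : rel V) : oct_set e [set: V].
Proof.
apply/existsP; exists set0; apply/andP.
by split; apply/forall_inP => x _; have := valP x; rewrite !inE.
Qed.

Definition oct (V : finType) (e : rel V) : nat :=
  #|[arg min_(S < [set: V] | oct_set e S) #|S|]|.

Lemma octP (V : finType) (e : rel V) :
  (exists2 S, oct_set e S & #|S| = oct e) /\
  (forall S, oct_set e S -> (oct e <= #|S|)%N).
Proof.
rewrite /oct; case: arg_minnP => [|S PS minS]; first exact: oct_setT.
by split; first by exists S.
Qed.

(* Rows and columns are indexed by the vertices through [enum_val]. *)

Definition adjacency_mx (R : nzRingType) (V : finType) (e : rel V) :
    'M[R]_#|V| :=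
  \matrix_(i, j) (e (enum_val i) (enum_val j))%:R.

Definition degree_mx (R : nzRingType) (V : finType) (e : rel V) :
    'M[R]_#|V| :=
  diag_mx (\row_i (degree e (enum_val i))%:R).

Definition laplacian (R : nzRingType) (V : finType) (e : rel V) :
    'M[R]_#|V| :=
  degree_mx R e - adjacency_mx R e.

(* [eigenvalue] refers to row eigenvectors, which is immaterial for the       *)
(* (symmetric) Laplacian.                                                     *)
Definition largest_eigenvalue (R : realFieldType) (m : nat) (A : 'M[R]_m)
    (a : R) : Prop :=
  eigenvalue A a /\ (forall b : R, eigenvalue A b -> b <= a).

(* Main.v *)
(* If S is a transversal of size s, then the test vector equal to 1 and -1 on the
   two colour classes outside S, and to 0 on S, has Laplacian form at least
   6n - 9s, so the Rayleigh principle gives n(6 - lambda) <= s(9 - lambda).  Since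
   the star around a vertex forces lambda >= 4, this yields
   3n(6 - lambda) <= 15 s <= 16 s. *)
Require Import Defs.
From mathcomp Require Import all_boot all_order all_algebra.
From mathcomp Require Import complex ring lra.

Import Order.TTheory GRing.Theory Num.Theory.
Local Open Scope ring_scope.

(** Over the complex extension of [R] the real symmetric matrix is Hermitian, so a unitary [P]
    diagonalises it. In the coordinates [w] of [u], both sides become sums of the squared moduli of
    [w], weighted by the spectral entries and by [a] respectively. *)
Lemma rayleigh_quotient_le (R : rcfType) (m : nat) (A : 'M[R]_m) (a : R)
    (u : 'rV[R]_m) :
  A^T = A -> largest_eigenvalue A a ->
  (u *m A *m u^T) 0 0 <= a * (u *m u^T) 0 0.
Proof.
move=> Asym [_ a_max]; pose f := real_complex R; pose B := map_mx f A.
have fR x : f x \is Num.real by apply/complex_realP; exists x.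
have Bherm : B \is hermsymmx.
  apply: realsym_hermsym; last by apply/mxOverP => i j; rewrite mxE fR.
  apply/is_hermitianmxP; rewrite expr0 scale1r map_mx_id //.
  by rewrite map_trmx Asym.
have /orthomx_spectralP := hermitian_normalmx Bherm.
set P := spectralmx B; set d := spectral_diag B => defB.
have Pu : P \is unitarymx := spectral_unitarymx B.
have PV : P \in unitmx := unitarymx_unit Pu.
(* Each spectral entry is real, with row [i] of [P] as eigenvector; [eigenvalue_map] then makes it
   an eigenvalue of [A] over [R], where the maximality of [a] applies. *)
have d_le i : d 0 i <= f a.
  have /mxOverP/(_ 0 i)/complex_realP[b db] := hermitian_spectral_diag_real Bherm.
  rewrite db lecR; apply: a_max; rewrite -(eigenvalue_map f) -/B.
  apply/eigenvalueP; exists (row i P).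
    rewrite -row_mul [in LHS]defB !mulmxA mulmxV // mul1mx.
    by apply/rowP => j; rewrite mxE mul_diag_mx !mxE db.
  apply/eqP => Pi0; have := row_mul i P (invmx P).
  rewrite Pi0 mul0mx mulmxV // => /rowP/(_ i)/eqP.
  by rewrite !mxE eqxx oner_eq0.
pose w := map_mx f u *m invmx P.
(* The inverse of [P] is its conjugate transpose, and [u] is real, hence fixed by conjugation. *)
have w_conj : P *m map_mx f u^T = (map_mx Num.conj w)^T.
  rewrite /w invmx_unitary // map_mxM trmx_mul map_mxCK trmxK.
  rewrite -map_trmx; congr (_ *m _^T).
  by apply/rowP => i; rewrite !mxE; apply/esym/CrealP/fR.
have formE : f ((u *m A *m u^T) 0 0) = \sum_i d 0 i * `|w 0 i| ^+ 2.
  transitivity ((map_mx f (u *m A *m u^T)) 0 0); first by rewrite [RHS]mxE.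
  rewrite !map_mxM -/B defB !mulmxA -/w -mulmxA w_conj mul_mx_diag mxE.
  by apply: eq_bigr => i _; rewrite !mxE normCK mulrAC mulrC.
have normE : f ((u *m u^T) 0 0) = \sum_i `|w 0 i| ^+ 2.
  transitivity ((map_mx f (u *m u^T)) 0 0); first by rewrite [RHS]mxE.
  rewrite map_mxM -[map_mx f u](mulmxKV PV) -/w -mulmxA w_conj mxE.
  by apply: eq_bigr => i _; rewrite !mxE normCK.
have le_f : f ((u *m A *m u^T) 0 0) <= f a * f ((u *m u^T) 0 0).
  rewrite formE normE mulr_sumr.
  by apply: ler_sum => i _; rewrite ler_wpM2r // exprn_ge0.
by rewrite -lecR [leRHS](rmorphM f).
Qed.

Section Graph.

Variables (V : finType) (e : rel V).

Lemma natr_degree (R : nzRingType) (v : V) :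
  (degree e v)%:R = \sum_w (e v w)%:R :> R.
Proof.
rewrite /degree -sum1_card natr_sum big_mkcond /=.
by apply: eq_bigr => w _; rewrite inE; case: (e v w).
Qed.

(** Both sides count ordered adjacent pairs: the fibre over an edge with ends [v] and [w] is exactly
    [(v, w)] and [(w, v)], which differ because there are no loops. *)
Lemma handshake : symmetric e -> irreflexive e ->
  (\sum_v degree e v = 2 * #|edges e|)%N.
Proof.
move=> e_sym e_irr; pose E := [set p : V * V | e p.1 p.2].
have -> : (\sum_v degree e v = #|E|)%N.
  rewrite -sum1_card (eq_bigl (fun p : V * V => e p.1 p.2)) => [|p]; last first.
    by rewrite inE.
  rewrite -(pair_big_dep xpredT e (fun _ _ => 1%N)) /=.
  apply: eq_bigr => v _; rewrite /degree -sum1_card.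
  by apply: eq_bigl => w; rewrite inE.
have edgesE : edges e = [set [set p.1; p.2] | p in E].
  by apply: eq_imset => p //; rewrite inE.
rewrite -sum1_card (partition_big_imset (fun p => [set p.1; p.2])) -edgesE /=.
rewrite mulnC -sum_nat_const; apply: eq_bigr => D.
rewrite edgesE => /imsetP[[v w]]; rewrite inE /= => evw ->.
have vw : v != w by apply: contraTneq evw => ->; rewrite e_irr.
rewrite sum1_card -(_ : #|[set (v, w); (w, v)]| = 2)%N; last first.
  by rewrite cards2 xpair_eqE negb_and vw.
apply: eq_card => -[x y]; rewrite !inE /= !xpair_eqE unfold_in /= inE /=.
apply/andP/orP => [[exy /eqP/setP eqD]|[]/andP[/eqP-> /eqP->]].
- have xy : x != y by apply: contraTneq exy => ->; rewrite e_irr.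
  have := eqD x; have := eqD y; rewrite !inE !eqxx orbT /=.
  move=> /esym/orP[]/eqP ey /esym/orP[]/eqP ex; rewrite ex ey !eqxx;
    by [left | right | rewrite ex ey eqxx in xy].
- by rewrite evw eqxx.
- by rewrite e_sym evw setUC eqxx.
Qed.

Variable R : rcfType.
Hypothesis e_sym : symmetric e.

(** This is the Rayleigh bound for [f] read as a row vector. The double sum meets every edge in both
    directions, so it is twice the Laplacian form; hence the factor 2 on the right. *)
Lemma laplacian_form_le (a : R) (f : V -> R) :
  largest_eigenvalue (laplacian R e) a ->
  \sum_v \sum_(w | e v w) (f v - f w) ^+ 2 <= 2 * a * \sum_v f v ^+ 2.
Proof.
move=> a_max; pose u : 'rV[R]_#|V| := \row_i f (enum_val i).
have enumE (F : V -> R) : \sum_v F v = \sum_(i < #|V|) F (enum_val i).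
  rewrite (reindex (@enum_val V V)) //=.
  by exists enum_rank => x _; rewrite ?enum_valK ?enum_rankK.
have Lsym : (laplacian R e)^T = laplacian R e.
  apply/matrixP => i j; rewrite !mxE e_sym; congr (_ - _).
  by rewrite eq_sym; case: eqVneq => // ->.
have := rayleigh_quotient_le _ _ _ _ u Lsym a_max.
have -> : (u *m u^T) 0 0 = \sum_v f v ^+ 2.
  by rewrite mxE enumE; apply: eq_bigr => i _; rewrite !mxE expr2.
have -> : (u *m laplacian R e *m u^T) 0 0
    = \sum_v (degree e v)%:R * f v ^+ 2 - \sum_v \sum_w (e v w)%:R * (f v * f w).
  rewrite /laplacian mulmxBr mulmxBl mxE [X in _ + X]mxE; congr (_ - _).
    rewrite mul_mx_diag mxE enumE; apply: eq_bigr => i _.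
    by rewrite !mxE mulrAC mulrC expr2.
  rewrite mxE [RHS]enumE; apply: eq_bigr => i _; rewrite !mxE enumE mulr_suml.
  by apply: eq_bigr => j _; rewrite !mxE e_sym; ring.
have -> : \sum_v \sum_(w | e v w) (f v - f w) ^+ 2
    = 2 * (\sum_v (degree e v)%:R * f v ^+ 2)
      - 2 * \sum_v \sum_w (e v w)%:R * (f v * f w).
  (* The two copies of the degree term are spread over ordered pairs, one through the first end and
     one through the second, to complete the square. *)
  have degE : \sum_v (degree e v)%:R * f v ^+ 2
      = \sum_v \sum_w (e v w)%:R * f v ^+ 2.
    by apply: eq_bigr => v _; rewrite natr_degree mulr_suml.
  have degE' : \sum_v (degree e v)%:R * f v ^+ 2
      = \sum_v \sum_w (e v w)%:R * f w ^+ 2.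
    rewrite degE exchange_big /=.
    by apply: eq_bigr => v _; apply: eq_bigr => w _; rewrite e_sym.
  rewrite mulr_natl mulr2n {1}degE degE' mulr_sumr -sumrN -!big_split /=.
  apply: eq_bigr => v _; rewrite mulr_sumr -sumrN -!big_split /= big_mkcond.
  by apply: eq_bigr => w _; case: (e v w) => /=; ring.
lra.
Qed.

Lemma laplacian_eigenvalue_gt_degree (a : R) (v : V) : irreflexive e ->
  largest_eigenvalue (laplacian R e) a -> (0 < degree e v)%N ->
  (degree e v).+1%:R <= a.
Proof.
move=> e_irr a_max d_gt0; set d : R := (degree e v)%:R.
have d0 : 0 < d by rewrite ltr0n.
(* This vector gives the quotient d + 1 exactly on the star around v. *)
pose f w : R := if w == v then d else if e v w then -1 else 0.
have := laplacian_form_le _ f a_max.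
have -> : \sum_w f w ^+ 2 = d ^+ 2 + d.
  rewrite (bigD1 v) //= /f eqxx; congr (_ + _).
  rewrite /d natr_degree [RHS](bigD1 v) //= e_irr add0r.
  by apply: eq_bigr => w /negPf->; case: (e v w); rewrite ?sqrrN ?expr1n ?expr0n.
(* Each of the [d] edges at [v] contributes [(d + 1) ^+ 2] in either direction: the row [x = v]
   gives one half, the terms [y = v] of the other rows give the second, and the remaining squares
   are dropped. *)
have lb : 2 * (d * (d + 1) ^+ 2) <= \sum_x \sum_(y | e x y) (f x - f y) ^+ 2.
  rewrite (bigD1 v) //= mulr_natl mulr2n; apply: lerD.
    rewrite {1}/d natr_degree mulr_suml [leRHS]big_mkcond /=; apply: ler_sum => w _.
    rewrite /f eqxx; case: ifP => [evw|_]; last by rewrite mul0r.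
    have -> : (w == v) = false by apply: contraTF evw => /eqP->; rewrite e_irr.
    by rewrite evw mul1r opprK.
  rewrite {1}/d natr_degree mulr_suml [leLHS](bigD1 v) //= e_irr mul0r add0r.
  apply: ler_sum => w wv; case: (boolP (e v w)) => [evw|_]; last first.
    by rewrite mul0r; apply: sumr_ge0 => x _; rewrite sqr_ge0.
  rewrite (bigD1 v) /=; last by rewrite e_sym.
  rewrite /f eqxx (negPf wv) evw mul1r -[leLHS]addr0; apply: lerD.
    by rewrite -[leLHS]sqrrN opprD addrC.
  by apply: sumr_ge0 => x _; rewrite sqr_ge0.
move=> /(le_trans lb) le_a; rewrite -natr1 -/d.
have pos : 0 < 2 * (d ^+ 2 + d) by nra.
by rewrite -(ler_pM2l pos); lra.
Qed.

(* An edge contributes 4, 1 or 0 to the form of the test vector according as 0, 1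
   or 2 of its ends lie in S, hence at least 4 - 3 (number of its ends in S). *)
Lemma oct_set_laplacian_le (a : R) (d : nat) (S : {set V}) :
  (forall v, degree e v = d) -> largest_eigenvalue (laplacian R e) a ->
  oct_set e S ->
  2 * d%:R * #|V|%:R - 3 * d%:R * #|S|%:R <= a * (#|V|%:R - #|S|%:R).
Proof.
move=> d_reg a_max /existsP[X /andP[indX indXC]].
(* [X] lives in the subtype of vertices outside [S], so [insub] decides membership there; its
   failure gives the value 0 on [S]. *)
pose f v : R := if insub v is Some x then if x \in X then 1 else -1 else 0.
pose s v : R := (v \in S)%:R.
have sumS : \sum_v s v = #|S|%:R.
  rewrite /s -sum1_card natr_sum [RHS]big_mkcond.
  by apply: eq_bigr => v _; case: (v \in S).
have := laplacian_form_le _ f a_max.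
have -> : \sum_v f v ^+ 2 = #|V|%:R - #|S|%:R.
  rewrite -sumS -sum1_card natr_sum -sumrB; apply: eq_bigr => v _; rewrite /f /s.
  case: insubP => [x|]; rewrite inE; last by move=> /negbNE -> /=; ring.
  by move=> /negPf -> _; case: (x \in X) => /=; ring.
have edge_ge v w : e v w -> 4 - 3 * s v - 3 * s w <= (f v - f w) ^+ 2.
  move=> evw; rewrite /f /s.
  case: insubP => [x|]; case: insubP => [y|]; rewrite !inE.
  (* With both ends outside [S], the independence of [X] and of its complement forces opposite
     signs, so the square is exactly 4. *)
  - move=> wS yw vS xv; rewrite (negPf vS) (negPf wS).
    have exy : induced e (~: S) x y by rewrite /induced /= xv yw.
    have hX : x \in X -> y \notin X.
      move=> xX; apply: contraTN exy => yX.
      exact: (forall_inP (forall_inP indX x xX) y yX).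
    have hXC : x \notin X -> y \in X.
      move=> xX; apply: contraTT exy => yX.
      have xXC : x \in ~: X by rewrite inE.
      by apply: (forall_inP (forall_inP indXC x xXC)); rewrite inE.
    case: (boolP (x \in X)) => [/hX/negPf->|/hXC->] /=; lra.
  - move=> /negbNE -> /negPf -> _; case: (x \in X) => /=; lra.
  - move=> /negPf -> _ /negbNE ->; case: (y \in X) => /=; lra.
  - move=> /negbNE -> /negbNE -> /=; lra.
have sum_reg (c : R) v : \sum_(w | e v w) c = d%:R * c.
  rewrite -(d_reg v) natr_degree mulr_suml big_mkcond.
  by apply: eq_bigr => w _; case: (e v w); rewrite ?mul1r ?mul0r.
have sum_s : \sum_v \sum_(w | e v w) s w = d%:R * #|S|%:R.
  rewrite (exchange_big_dep predT) //= -sumS mulr_sumr; apply: eq_bigr => w _.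
  by rewrite -(sum_reg _ w); apply: eq_bigl => v; rewrite e_sym.
(* There are [d * #|V|] ordered adjacent pairs, and each vertex of [S] is the first end of [d] of
   them and the second end of [d], which costs [3 * 2 * d]. *)
have lb : 4 * d%:R * #|V|%:R - 6 * d%:R * #|S|%:R
    <= \sum_v \sum_(w | e v w) (f v - f w) ^+ 2.
  apply: le_trans (ler_sum _ (fun v _ => ler_sum _ (edge_ge v))).
  have -> : \sum_v \sum_(w | e v w) (4 - 3 * s v - 3 * s w)
      = \sum_v (d%:R * (4 - 3 * s v) - 3 * \sum_(w | e v w) s w).
    by apply: eq_bigr => v _; rewrite sumrB sum_reg mulr_sumr.
  rewrite sumrB -!mulr_sumr sum_s sumrB -mulr_sumr sumS.
  rewrite sumr_const -mulr_natr; lra.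
by move=> /(le_trans lb); lra.
Qed.

End Graph.

Theorem corollary11 (R : rcfType) (n : nat) (V : finType) (e : rel V)
    (lambda_n : R) :
  symmetric e -> irreflexive e -> #|V| = n -> cubic e ->
  largest_eigenvalue (laplacian R e) lambda_n ->
  (\sum_(v : V) (degree e v)%:R ^+ 2 - #|edges e|%:R * lambda_n) / 8
    <= (oct e)%:R
  /\ (\sum_(v : V) (degree e v)%:R ^+ 2 - #|edges e|%:R * lambda_n) / 8
    = 3 * n%:R * (6 - lambda_n) / 16.
Proof.
move=> e_sym e_irr cardV e_cubic l_max.
have -> : \sum_(v : V) (degree e v)%:R ^+ 2 = 9 * n%:R :> R.
  rewrite (eq_bigr (fun=> 9)) => [|v _]; last by rewrite e_cubic; ring.
  by rewrite sumr_const cardV mulr_natr.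
have edgesE : 3 * n%:R = 2 * #|edges e|%:R :> R.
  rewrite -!natrM -(handshake _ _ e_sym e_irr) (eq_bigr (fun=> 3%N)) //.
  by rewrite sum_nat_const cardV mulnC.
have boundE : (9 * n%:R - #|edges e|%:R * lambda_n) / 8
    = 3 * n%:R * (6 - lambda_n) / 16.
  have -> : #|edges e|%:R = 3 * n%:R / 2 :> R by lra.
  by field.
split=> //; rewrite boundE.
have [[S octS <-] _] := octP e.
(* The bound on [lambda_n] from a star needs a vertex; for [n = 0] the left side is 0. *)
have [->|n_gt0] := posnP n; first by rewrite mulr0 !mul0r ler0n.
have [v _] : exists v : V, v \in V by apply/card_gt0P; rewrite cardV.
have l_ge4 : 4 <= lambda_n.
  have := laplacian_eigenvalue_gt_degree _ _ _ e_sym _ v e_irr l_max.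
  by rewrite e_cubic; apply.
have := oct_set_laplacian_le _ _ _ e_sym _ _ _ e_cubic l_max octS; rewrite cardV.
have := ler0n R #|S|; set s := #|S|%:R => s_ge0 le_s.
(* This product turns [(9 - lambda_n) * s] into at most [5 * s]; it is supplied because [lra] treats
   [lambda_n * s] as an atom. *)
have : 0 <= (lambda_n - 4) * s by rewrite mulr_ge0 // subr_ge0.
lra.
Qed.
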